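(* Let $q$ be a prime power and let $\mathcal C$ be a hypergraphic additive code (over $\mathbb F_{q^h}$, $h\geq 1$) with a connected underlying hypergraph $H$. Then $$d(\mathcal C)=\lambda(H).$$ In particular, if $H$ is a connected $r$-uniform hypergraph ($r\ge2$) with $N$ vertices and $m$ edges, then $\mathcal C_H$ is an $\bigl[m,\frac{N-1}{r-1},\lambda(H)\bigr]_q^{r-1}$ code, i.e. an $\mathbb F_q$-subspace of $\mathbb F_{q^{r-1}}^m$ of $\mathbb F_q$-dimension $N-1$ and minimum distance $\lambda(H)$.
   Context: A finite hypergraph is a triple $H=(V,\mathcal E,\psi_H)$ with finite sets $V$, $\mathcal E$ and a map $\psi_H:\mathcal E\to2^V\setminus\{\emptyset\}$ (distinct edges may have the same vertex set; $e$ is identified with $\psi_H(e)$). It is $r$-uniform if $|e|=r$ for all edges. Vertices are in the same component if joined by a walk $u_0,e_1,u_1,\ldots,e_\ell,u_\ell$ with $u_{i-1},u_i\in e_i$; $H$ is connected if it has one component. For $A\subseteq\mathcal E$, $\kappa(A)$ is the number of components of $(V,A,\psi_H|_A)$, isolated vertices included, and $f_H(A):=|V|-\kappa(A)$. For $\emptyset\ne S\subsetneq V$, the edge cut $\delta_H(S)$ is the set of edges meeting both $S$ and $V\setminus S$; for connected $H$ with at least two vertices, $\lambda(H):=\min_{\emptyset\ne S\subsetneq V}|\delta_H(S)|$. An additive code $\mathcal C\subseteq\mathbb F_{q^h}^n$ is an $\mathbb F_q$-subspace, of $\mathbb F_q$-dimension $k$ say; its minimum distance $d(\mathcal C)$ is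 the minimum Hamming weight (number of nonzero coordinates) of a nonzero codeword. It is nondegenerate if every coordinate map $c\mapsto c_i$ on $\mathcal C$ is nonzero. For a set $A$ of coordinates, $\mathcal C(A)$ is the subspace of codewords vanishing on $A$ and $\rho_{\mathcal C}(A):=k-\dim_{\mathbb F_q}\mathcal C(A)$. A nondegenerate additive code $\mathcal C\subseteq\mathbb F_{q^h}^n$ is hypergraphic if there is a hypergraph $H=(V,\{1,\ldots,n\},\psi_H)$ with $\rho_{\mathcal C}=f_H$; any such $H$ is an underlying hypergraph of $\mathcal C$. (Every edge of an underlying hypergraph then has at least two vertices.) Code $\mathcal C_H$ of an $r$-uniform $H$: put $h=r-1$, fix for each edge an ordering $e=(v_{e,1},\ldots,v_{e,r})$ and an $\mathbb F_q$-linear bijection $\iota:\mathbb F_q^h\to\mathbb F_{q^h}$. For $a:V\to\mathbb F_q$ let $\Phi_H(a):=\bigl(\iota\bigl((a(v_{e,j})-a(v_{e,1}))_{2\le j\le r}\bigr)\bigr)_{e\in\mathcal E}\in\mathbb F_{q^h}^{|\mathcal E|}$, and $\mathcal C_H:=\operatorname{Im}(\Phi_H)$. *)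

(* Defs.v *)
From HB Require Import structures.
From mathcomp Require Import all_boot all_order all_algebra all_field.

Set Implicit Arguments.
Unset Strict Implicit.
Unset Printing Implicit Defensive.

Import GRing.Theory.
Local Open Scope ring_scope.

Record hypergraph (V E : finType) := Hypergraph {
  vertices_of :> E -> {set V};
  vertices_of_neq0 : forall e, vertices_of e != set0
}.

Section Hypergraphs.

Variables (V E : finType) (H : hypergraph V E).

Definition uniform (r : nat) := forall e, #|H e| = r.

(* One step of a walk using edges of A only; [connect (step A) x y] is then
   the existence of such a walk from x to y, the trivial one included. *)
Definition step (A : {set E}) : rel V :=
  [rel x y | [exists e in A, (x \in H e) && (y \in H e)]].

Definition ncomponents (A : {set E}) : nat := n_comp (step A) V.

Definition connected : Prop := ncomponents [set: E] = 1%N.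

Definition hrank (A : {set E}) : nat := (#|V| - ncomponents A)%N.

Definition edge_cut (S : {set V}) : {set E} :=
  [set e | (H e :&: S != set0) && (H e :&: ~: S != set0)].

(* The default value #|E| is an upper bound on the size of every edge cut, so
   it does not affect the minimum as soon as 1 < #|V|. *)
Definition edge_connectivity : nat :=
  \big[minn/#|E|]_(S : {set V} | (S != set0) && (S != [set: V]))
    #|edge_cut S|.

End Hypergraphs.

(* With #|F| = q and \dim {:L} = h, the field L is F_(q^h), and a value of type
   {vspace {ffun I -> L}} is an F-subspace (not an L-subspace in general) of
   L^I, i.e. an additive code whose coordinates are indexed by I. *)
Section AdditiveCodes.

Variables (F : finFieldType) (L : fieldExtType F) (I : finType).

Implicit Types (C : {vspace {ffun I -> L}}) (A : {set I}).

Definition coordinate (i : I) (c : {ffun I -> L}) : L := c i.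

Lemma coordinate_linear i : linear (coordinate i).
Proof. by move=> a u v; rewrite /coordinate !ffunE. Qed.

HB.instance Definition _ i :=
  GRing.isLinear.Build F {ffun I -> L} L *:%R (coordinate i)
    (coordinate_linear i).

Definition weight (c : {ffun I -> L}) : nat := #|[set i | c i != 0]|.

Definition is_min_distance C (d : nat) : Prop :=
  (exists c, [/\ c \in C, c != 0 & weight c = d]) /\
  (forall c, c \in C -> c != 0 -> (d <= weight c)%N).

Definition nondegenerate C : Prop := forall i, exists2 c, c \in C & c i != 0.

Definition vanishing C A : {vspace {ffun I -> L}} :=
  (C :&: \bigcap_(i in A) lker (linfun (coordinate i)))%VS.

Lemma mem_vanishing C A c :
  (c \in vanishing C A) = (c \in C) && [forall i in A, c i == 0].
Proof.
rewrite memv_cap; congr (_ && _).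
apply/idP/forall_inP => [/subv_bigcapP cA i /cA | cA].
  by rewrite -memvE memv_ker lfunE.
by apply/subv_bigcapP => i /cA c0; rewrite -memvE memv_ker lfunE.
Qed.

Definition code_rank C A : nat := (\dim C - \dim (vanishing C A))%N.

Definition underlying (V : finType) (H : hypergraph V I) C : Prop :=
  forall A : {set I}, code_rank C A = hrank H A.

Definition hypergraphic C : Prop :=
  nondegenerate C /\ exists (V : finType) (H : hypergraph V I), underlying H C.

(* C is an [n, k, d]_q^h code; k is the F_q-dimension of C divided by h, hence
   rational in general. *)
Definition is_additive_code C (q h n : nat) (k : rat) (d : nat) : Prop :=
  [/\ #|F| = q, \dim {:L} = h, #|I| = n, (\dim C)%:R / h%:R = k
    & is_min_distance C d].

End AdditiveCodes.

Section CodeOfHypergraph.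

Variables (F : finFieldType) (L : fieldExtType F) (V E : finType) (r : nat).
Variables (vs : E -> r.-tuple V) (iota : {linear 'rV[F]_r.-1 -> L}).

Definition edge_ordering (H : hypergraph V E) : Prop :=
  forall e, uniq (vs e) /\ [set v in vs e] = H e.

(* For r > 0 the indices 0 and j.+1 are within the bounds of vs e. *)
Definition edge_differences (a : {ffun V -> F^o}) (e : E) : 'rV[F]_r.-1 :=
  let s : seq F := [seq a v | v <- vs e] in \row_(j < r.-1) (s`_j.+1 - s`_0).

Definition Phi (a : {ffun V -> F^o}) : {ffun E -> L} :=
  [ffun e => iota (edge_differences a e)].

Lemma Phi_linear : linear Phi.
Proof.
move=> c a b; apply/ffunP => e; rewrite !ffunE -linearP; congr (iota _).
have nthE i : [seq (c *: a + b) v | v <- vs e]`_i =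
    c * [seq a v | v <- vs e]`_i + [seq b v | v <- vs e]`_i.
  elim: (tval (vs e)) i => [|v s IHs] [|i] //=; rewrite ?mulr0 ?addr0 //.
  by rewrite !ffunE.
by apply/rowP => j; rewrite !mxE !nthE mulrBr opprD addrACA.
Qed.

HB.instance Definition _ :=
  GRing.isLinear.Build F {ffun V -> F^o} {ffun E -> L} *:%R Phi Phi_linear.

Definition hypergraph_code : {vspace {ffun E -> L}} := limg (linfun Phi).

Lemma hypergraph_codeP c :
  reflect (exists a, c = Phi a) (c \in hypergraph_code).
Proof.
apply: (iffP memv_imgP) => [[a _ ->]|[a ->]]; first by exists a; rewrite lfunE.
by exists a; rewrite ?memvf ?lfunE.
Qed.

End CodeOfHypergraph.

(* Main.v *)
Require Import Defs.
From mathcomp Require Import all_boot all_order all_algebra all_field.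
From mathcomp Require Import zify.
Import Order.TTheory GRing.Theory.
Local Open Scope ring_scope.

(** For a set [A] of edges, nonzero codewords vanishing on [A] exist if and only
    if the components of [(V, A)] are at least two, i.e. if and only if some
    edge cut avoids [A].  Taking for [A] the zero set of a codeword of minimum
    weight, or the complement of a minimum edge cut, gives the two inequalities
    between the minimum distance and the edge connectivity.  For the code of a
    uniform hypergraph, [Phi a] vanishes at [e] exactly when [a] is constant on
    [e], so the kernel consists of the constants and the indicator function of
    one side of a cut yields a codeword supported on the cut. *)

Section Cuts.

Context {V E : finType} (H : hypergraph V E).

Implicit Types (A : {set E}) (S : {set V}).

(** Disconnectedness of [(V, A)] phrased by a cut, the form that can be traded directly for a
    codeword. *)
Definition separable A : bool :=
  [exists S : {set V}, [&& S != set0, S != [set: V] & [disjoint A & edge_cut H S]]].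

Lemma step_sym A : symmetric (step H A).
Proof.
by move=> x y; apply: eq_existsb => e; rewrite [(x \in _) && _]andbC.
Qed.

(** An edge misses the cut when it lies inside [S] or inside its complement. As [x] and [y] can be
    swapped, one implication covers both sides. *)
Lemma disjoint_edge_cutP A S :
  reflect (forall e x y, e \in A -> x \in H e -> y \in H e -> x \in S -> y \in S)
          [disjoint A & edge_cut H S].
Proof.
apply: (iffP idP) => [dAS e x y eA xe ye xS | closedS].
  have := disjointFr dAS eA; apply: contraFT => yNS; rewrite inE.
  by apply/andP; split; apply/set0Pn; [exists x | exists y]; rewrite !inE ?xe ?ye.
apply/pred0P => e /=; apply/negP; rewrite inE => /and3P[eA /set0Pn[x] + /set0Pn[y]].
rewrite !inE => /andP[xe xS] /andP[ye]; apply/negP; rewrite negbK.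
exact: closedS eA xe ye xS.
Qed.

(** Components are counted by their roots. A side [S] of a cut avoiding [A] is closed under [step],
    so points inside and outside have distinct roots; conversely, the component of one of two
    distinct roots is such a side. *)
Lemma separableE A : separable A = (1 < ncomponents H A)%N.
Proof.
have csym := sym_connect_sym (step_sym A).
apply/existsP/card_gt1P => [[S /and3P[/set0Pn[x xS]]] | [x [y [xr yr xy]]]].
  rewrite -subTset => /subsetPn[y _ yNS] /disjoint_edge_cutP closedS.
  have stepS : closed (step H A) (mem S).
    apply: (intro_closed csym) => u v /exists_inP[e eA /andP[ue ve]].
    exact: closedS eA ue ve.
  exists (fingraph.root (step H A) x), (fingraph.root (step H A) y).
  rewrite !inE !roots_root // root_connect //; split=> //.
  by apply: contra yNS => /(closed_connect stepS) <-.
exists [set z | connect (step H A) x z]; apply/and3P; split.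
- by apply/set0Pn; exists x; rewrite inE.
- rewrite -subTset; apply/subsetPn; exists y; rewrite ?inE //.
  move: xr yr xy; rewrite !inE !andbT => /eqP xr /eqP yr.
  by rewrite -(root_connect csym) xr yr.
apply/disjoint_edge_cutP => e u v eA ue ve; rewrite !inE => /connect_trans; apply.
by apply/connect1/exists_inP; exists e; rewrite ?ue.
Qed.

(** If [a] took two values, a level set of [a] would be one side of a cut avoiding [A]. *)
Lemma constant_of_nonseparable (T : eqType) (a : V -> T) A :
    (forall e x y, e \in A -> x \in H e -> y \in H e -> a x = a y) ->
  ~~ separable A -> forall x y, a x = a y.
Proof.
move=> a_edge + x y; apply: contraNeq => axy; apply/existsP.
exists [set z | a z == a x]; apply/and3P; split.
- by apply/set0Pn; exists x; rewrite inE.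
- by rewrite -subTset; apply/subsetPn; exists y; rewrite ?inE // eq_sym.
apply/disjoint_edge_cutP => e u v eA ue ve.
by rewrite !inE (a_edge e u v).
Qed.

Lemma edge_connectivity_le S :
  S != set0 -> S != [set: V] -> (edge_connectivity H <= #|edge_cut H S|)%N.
Proof.
move=> S0 ST; rewrite /edge_connectivity -minEnat -leEnat.
by apply: (bigmin_le_cond _ (fun S => #|edge_cut H S|)); rewrite S0.
Qed.

Lemma edge_connectivity_attained : (1 < #|V|)%N ->
  exists S, [/\ S != set0, S != [set: V] & #|edge_cut H S| = edge_connectivity H].
Proof.
move=> /card_gt1P[x [y [_ _ xy]]].
have Px : ([set x] != set0) && ([set x] != [set: V]).
  apply/andP; split; first by apply/set0Pn; exists x; rewrite inE.
  by rewrite -subTset; apply/subsetPn; exists y; rewrite // !inE eq_sym.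
(* The singleton shows that the range is nonempty; the default [#|E|] bounds every cut, so the
   minimum is reached at an actual [S]. *)
rewrite /edge_connectivity -minEnat (bigmin_eq_arg _ [set x]) //; last first.
  by move=> S _; rewrite leEnat max_card.
by case: arg_minP => // S /andP[S0 ST] _; exists S.
Qed.

End Cuts.

Section MinimumDistance.

Context {F : finFieldType} {L : fieldExtType F} {I V : finType}.
Context (H : hypergraph V I) (C : {vspace {ffun I -> L}}).

(** Shared by both halves of the theorem, which differ only in how the equivalence is
    established. *)
Lemma min_distance_of_separable :
    (forall A, (vanishing C A != 0%VS) = separable H A) -> (1 < #|V|)%N ->
  is_min_distance C (edge_connectivity H).
Proof.
move=> CsepE V_gt1.
have le_weight c : c \in C -> c != 0 -> (edge_connectivity H <= weight c)%N.
  move=> cC c0; have: separable H [set i | c i == 0].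
    rewrite -CsepE; apply: contra c0 => /eqP C0; rewrite -memv0 -C0 mem_vanishing cC.
    by apply/forall_inP => i; rewrite inE.
  case/existsP=> S /and3P[S0 ST dS]; apply: leq_trans (edge_connectivity_le H S S0 ST) _.
  (* The cut avoids the zero set of [c], hence lies in its support. *)
  apply/subset_leq_card/subsetP => i iS; rewrite inE.
  by apply/negP => ci0; have := disjointFl dS iS; rewrite inE ci0.
split=> //; have [S [S0 ST cutS]] := edge_connectivity_attained H V_gt1.
have: vanishing C (~: edge_cut H S) != 0%VS.
  rewrite CsepE; apply/existsP; exists S; rewrite S0 ST /=.
  by rewrite disjoints_subset.
rewrite -vpick0 => c0; have := memv_pick (vanishing C (~: edge_cut H S)).
set c := vpick _ in c0 *; rewrite mem_vanishing => /andP[cC /forall_inP c_cut].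
(* The support of [c] lies inside the minimum cut, so only the upper bound on its weight remains. *)
exists c; split=> //; apply/eqP; rewrite eqn_leq le_weight // andbT -cutS.
apply/subset_leq_card/subsetP => i; rewrite inE.
by apply: contraNT => iS; apply: c_cut; rewrite in_setC.
Qed.

(** Evaluate the rank identity on all edges, where only the zero codeword vanishes. *)
Lemma dim_underlying : underlying H C -> connected H -> \dim C = #|V|.-1.
Proof.
move=> rankE conn; have := rankE [set: I].
rewrite /hrank conn subn1 /code_rank.
suff ->: vanishing C [set: I] = 0%VS by rewrite dimv0 subn0.
apply/eqP; rewrite -subv0; apply/subvP => c.
rewrite mem_vanishing memv0 => /andP[_ /forall_inP c0].
by apply/eqP/ffunP => i; rewrite ffunE; apply/eqP/c0.
Qed.

(** The rank identity says that [vanishing C A] has dimension [ncomponents H A - 1]. Subtractions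
    being truncated, [1 < #|V|] and the bound by [\dim C] enter the arithmetic. *)
Lemma vanishing_neq0_underlying : underlying H C -> connected H -> (1 < #|V|)%N ->
  forall A, (vanishing C A != 0%VS) = separable H A.
Proof.
move=> rankE conn V_gt1 A; have := rankE A; rewrite /code_rank /hrank separableE.
have: (\dim (vanishing C A) <= \dim C)%N by rewrite dimvS // capvSl.
by rewrite dim_underlying // -dimv_eq0; lia.
Qed.

End MinimumDistance.

Section HypergraphCode.

Context {F : finFieldType} {L : fieldExtType F} {V E : finType} {r : nat}.
Context (H : hypergraph V E) (vs : E -> r.-tuple V).
Context (iota : {linear 'rV[F]_r.-1 -> L}).
Context (r_gt0 : (0 < r)%N) (iota_inj : injective iota) (vsH : edge_ordering vs H).

Lemma Phi_eq0P (a : {ffun V -> F^o}) e :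
  reflect (forall x y, x \in H e -> y \in H e -> a x = a y) (Phi vs iota a e == 0).
Proof.
have memH x : (x \in H e) = (x \in vs e) by rewrite -(vsH e).2 inE.
rewrite ffunE -(linear0 iota) (inj_eq iota_inj).
have nthE v0 i : (i < r)%N -> [seq (a v : F) | v <- vs e]`_i = a (nth v0 (vs e) i).
  by move=> ir; rewrite (nth_map v0) ?size_tuple.
have hd_lt (j : 'I_r.-1) : (j.+1 < r)%N by rewrite -ltn_predRL.
apply: (iffP eqP) => [diff0 x y | a_const].
  suff a_head z : z \in H e -> a z = [seq (a v : F) | v <- vs e]`_0.
    by move=> /a_head -> /a_head ->.
  rewrite memH => zvs; have iz := zvs; rewrite -index_mem size_tuple in iz.
  rewrite -[in LHS](nth_index z zvs) -nthE //.
  (* Position 0 is the reference vertex itself; position [i.+1] is governed by entry [i] of the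
     difference row. *)
  case: (index z (vs e)) iz => [//|i] i_lt.
  have i_lt' : (i < r.-1)%N by rewrite -ltnS prednK.
  have /rowP/(_ (Ordinal i_lt')) := diff0.
  by rewrite !mxE => /eqP; rewrite subr_eq0 => /eqP.
have [v0 _] : exists v0, v0 \in H e by apply/set0Pn/vertices_of_neq0.
apply/rowP => j; rewrite !mxE !(nthE v0) //; apply/eqP; rewrite subr_eq0; apply/eqP.
by apply: a_const; rewrite memH mem_nth ?size_tuple.
Qed.

Lemma vanishing_hypergraph_code A : connected H ->
  (vanishing (hypergraph_code vs iota) A != 0%VS) = separable H A.
Proof.
move=> conn; have nsepT : ~~ separable H [set: E] by rewrite separableE conn.
apply/idP/idP.
  rewrite -vpick0; apply: contraNT => nsepA.
  have := memv_pick (vanishing (hypergraph_code vs iota) A).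
  rewrite mem_vanishing => /andP[/hypergraph_codeP[a ->] /forall_inP aA].
  have a_const : forall x y, a x = a y.
    apply: (constant_of_nonseparable H _ a A) nsepA => e x y /aA/Phi_eq0P; exact.
  apply/eqP/ffunP => e; rewrite [RHS]ffunE; apply/eqP/Phi_eq0P => x y _ _.
  exact: a_const.
case/existsP=> S /and3P[S0 ST /disjoint_edge_cutP closedS].
pose a : {ffun V -> F^o} := [ffun v => (v \in S)%:R].
have aA : Phi vs iota a \in vanishing (hypergraph_code vs iota) A.
  rewrite mem_vanishing; apply/andP; split; first by apply/hypergraph_codeP; exists a.
  apply/forall_inP => e eA; apply/Phi_eq0P => x y xe ye; rewrite !ffunE.
  by congr (_%:R); congr nat_of_bool; apply/idP/idP; apply: closedS eA _ _.
(* If the indicator of [S] were mapped to zero, no edge at all would cross [S], against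
   connectedness. *)
apply: contraNneq nsepT => van0; move: aA; rewrite van0 memv0 => /eqP/ffunP a0.
apply/existsP; exists S; rewrite S0 ST; apply/disjoint_edge_cutP => e x y _ xe ye xS.
have /Phi_eq0P/(_ x y xe ye)/eqP : Phi vs iota a e == 0 by rewrite a0 ffunE.
by rewrite !ffunE xS; case: (y \in S); rewrite ?oner_eq0.
Qed.

(** Rank-nullity for [Phi], whose kernel is the line of constant functions. *)
Lemma dim_hypergraph_code : connected H -> (0 < #|V|)%N ->
  \dim (hypergraph_code vs iota) = #|V|.-1.
Proof.
move=> conn V_gt0; have nsepT : ~~ separable H [set: E] by rewrite separableE conn.
pose one : {ffun V -> F^o} := [ffun=> 1].
have kerE : lker (linfun (Phi vs iota)) = <[one]>%VS.
  have [v0 _] := card_gt0P V_gt0.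
  apply/vspaceP => a; rewrite memv_ker lfunE; apply/idP/vlineP => [/eqP/ffunP a0|[k ->]].
    exists (a v0); apply/ffunP => v; rewrite !ffunE [RHS]mulr1.
    apply: (constant_of_nonseparable H _ a [set: E]) nsepT _ _ => e x y _.
    by apply/Phi_eq0P; rewrite a0 ffunE.
  apply/eqP/ffunP => e; rewrite [RHS]ffunE.
  by apply/eqP/Phi_eq0P => x y _ _; rewrite !ffunE.
have := limg_ker_dim (linfun (Phi vs iota)) fullv.
rewrite capfv kerE dim_vline dimvf.
have -> : one != 0.
  have [v0 _] := card_gt0P V_gt0.
  by apply/eqP => /ffunP/(_ v0); rewrite !ffunE; apply/eqP; exact: oner_neq0.
by move=> dimE; apply/eqP; rewrite -eqSS prednK // -[_.+1]add1n dimE /dim /= muln1.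
Qed.

End HypergraphCode.

Theorem theorem5p1 (q : nat) (F : finFieldType) (hq : #|F| = q) :
  (forall (h : nat) (L : fieldExtType F) (n : nat)
          (C : {vspace {ffun 'I_n -> L}})
          (V : finType) (H : hypergraph V 'I_n),
     (1 <= h)%N -> \dim {:L} = h ->
     hypergraphic C -> underlying H C -> connected H -> (1 < #|V|)%N ->
     is_min_distance C (edge_connectivity H))
  /\
  (forall (r N m : nat) (L : fieldExtType F) (V E : finType)
          (H : hypergraph V E) (vs : E -> r.-tuple V)
          (iota : {linear 'rV[F]_r.-1 -> L}),
     (2 <= r)%N -> #|V| = N -> #|E| = m -> (1 < N)%N ->
     \dim {:L} = r.-1 -> bijective iota ->
     uniform H r -> connected H -> edge_ordering vs H ->
     is_additive_code (hypergraph_code vs iota) q r.-1 m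
       ((N%:R - 1) / (r%:R - 1)) (edge_connectivity H)
     /\ \dim (hypergraph_code vs iota) = N.-1).
Proof.
split=> [h L n C V H _ _ _ rankE conn V_gt1 |
         r N m L V E H vs iota r_ge2 <- <- V_gt1 dimL iota_bij unif conn vsH].
  apply: min_distance_of_separable => //.
  exact: vanishing_neq0_underlying.
have r_gt0 := ltnW r_ge2; have iota_inj := bij_inj iota_bij.
have dimC := dim_hypergraph_code H vs iota r_gt0 iota_inj vsH conn (ltnW V_gt1).
split=> //; split=> //.
  (* Both predecessors cast to true rational differences because [#|V|] and [r] are positive. *)
  by rewrite dimC -!subn1 !natrB // ltnW.
apply: min_distance_of_separable => // A.
exact: vanishing_hypergraph_code.
Qed.
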